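(* An $m$-isometry on a Banach space $X$ is not convex-cyclic.
   Context: Here $m$ is a positive integer. For a positive integer $m$ and a real number $p>0$, a bounded linear operator $T$ on $X$ is an $(m,p)$-isometry if for every $x\in X$, $$\sum_{k=0}^m (-1)^{m-k}\binom{m}{k}\|T^k x\|^p=0.$$ $T$ is an $m$-isometry if it is an $(m,p)$-isometry for some $p>0$. A bounded linear operator $T$ on $X$ is convex-cyclic if there is $x\in X$ such that the convex hull of the orbit $\{T^n x : n=0,1,2,\ldots\}$ is dense in $X$. *)

(* Defs.v *)
From HB Require Import structures.
From mathcomp Require Import all_boot all_order all_algebra.
From mathcomp Require Import complex.
From mathcomp Require Import all_classical all_reals all_analysis.

Set Implicit Arguments.
Unset Strict Implicit.
Unset Printing Implicit Defensive.

Import Order.TTheory GRing.Theory Num.Theory.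
Import numFieldNormedType.Exports.

Local Open Scope classical_set_scope.
Local Open Scope ring_scope.

Definition bounded_operator (K : numFieldType) (X : normedModType K)
    (T : X -> X) : Prop :=
  exists M : K, forall x : X, `|T x| <= M * `|x|.

(* The norm of a [normedModType K] takes its values in [K] itself.  In order
   to raise it to a real power, it is transported to [R] by [re], which is
   meant to be the identity when [K] is [R], and the real part when [K] is
   [R[i]] (where the norm is a nonnegative real element of [R[i]]). *)
Definition mp_isometry (R : realType) (K : numFieldType) (re : K -> R)
    (X : normedModType K) (m : nat) (p : R) (T : X -> X) : Prop :=
  forall x : X,
    \sum_(k < m.+1) (-1) ^+ (m - k) * 'C(m, k)%:R * (re `|iter k T x|) `^ p = 0.

Definition m_isometry (R : realType) (K : numFieldType) (re : K -> R)
    (X : normedModType K) (m : nat) (T : X -> X) : Prop :=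
  exists2 p : R, 0 < p & mp_isometry re m p T.

Definition orbit_of (X : Type) (T : X -> X) (x : X) : set X :=
  range (fun n : nat => iter n T x).

(* In [convex_set] the coefficients range over the elements [t] of [K] with
   [0 <= t <= 1].  The order of [R[i]] only relates complex numbers with the
   same imaginary part, so for [K = R[i]] these are real coefficients too. *)
Definition convex_hull (K : numDomainType) (X : lmodType K) (A : set X) :
    set X :=
  smallest (@convex_set K X) A.

Definition convex_cyclic (K : numFieldType) (X : normedModType K)
    (T : X -> X) : Prop :=
  exists x : X, dense (convex_hull (orbit_of T x)).

(* Main.v *)
Require Import Defs.
From HB Require Import structures.
From mathcomp Require Import all_boot all_order all_algebra.
From mathcomp Require Import complex.
From mathcomp Require Import all_classical all_reals all_analysis.

Import Order.TTheory GRing.Theory Num.Theory.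
Import numFieldNormedType.Exports.

Local Open Scope classical_set_scope.
Local Open Scope ring_scope.

(** Put [a x n = `|T^n x| ^ p]. For an [(m + 1, p)]-isometry the [m]-th
    difference of [a x] does not depend on its argument; let [lead m x] be this
    constant. Comparing two sequences of the form [a x] for large [n] compares
    their leads, so [lead m] is nonnegative and inherits from the norm the
    inequality [lead m z <= max (lead m x) (lead m y)] for [z] on the segment
    from [x] to [y]. Hence [lead m x <= lead m x0] defines a closed convex set,
    which is [T]-invariant and contains the orbit of [x0]. If that orbit has a
    dense convex hull then [lead m] is bounded, hence zero by homogeneity, and
    [T] is an [(m, p)]-isometry; descend to [m = 0], where [X] is trivial. *)

Lemma iter_telescopeE (R : pzRingType) (m : nat) (u : nat -> R) (n : nat) :
  iter m telescope u n =
  \sum_(k < m.+1) (-1) ^+ (m - k) * 'C(m, k)%:R * u (n + k)%N.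
Proof.
elim: m n => [|m IH] n.
  by rewrite big_ord1 subnn bin0 !mul1r addn0.
rewrite iterS -[LHS]/(iter m telescope u n.+1 - iter m telescope u n) !IH.
rewrite [RHS]big_ord_recl subn0 bin0 mulr1 addn0.
(* Pascal's rule: the ['C(m, i)] half is the difference at [n.+1]; the ['C(m, i.+1)] half, with the
   split-off term [k = 0], is minus the one at [n]. *)
under [in RHS]eq_bigr => i _.
  rewrite lift0 subSS binS natrD mulrDr mulrDl addnS -addSn.
  over.
rewrite big_split/= addrA [RHS]addrC; congr (_ + _).
rewrite [in LHS]big_ord_recl [in RHS]big_ord_recr/=.
rewrite (@bin_small m m.+1)// mulr0 mul0r.
rewrite addr0 subn0 bin0 mulr1 addn0 exprS mulN1r mulNr opprD; congr (_ + _).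
rewrite -sumrN; apply: eq_bigr => i _; rewrite /bump leq0n add1n addnS -addSn.
by rewrite -(subnSK (ltn_ord i)) exprS mulN1r !mulNr.
Qed.

Lemma iter_telescopeB (R : pzRingType) (m : nat) (u v : nat -> R) (n : nat) :
  iter m telescope (fun k => u k - v k) n =
  iter m telescope u n - iter m telescope v n.
Proof.
by rewrite !iter_telescopeE -sumrB; apply: eq_bigr => i _; rewrite mulrBr.
Qed.

Lemma iter_telescope_cst (R : pzRingType) (m : nat) (u : nat -> R) :
  (forall n, iter m.+1 telescope u n = 0) ->
  forall n, iter m telescope u n = iter m telescope u 0%N.
Proof.
by move=> u0; elim=> // n <-; apply/eqP; rewrite -subr_eq0; apply/eqP/u0.
Qed.

(** Induction on [m]: a sequence whose steps eventually stay above some [d > 0] grows at least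
    linearly, so it ends up above [d] too. *)
Lemma iter_telescope_near_gt0 (R : archiRealFieldType) (m : nat) (u : nat -> R)
    (c : R) : 0 < c -> (\forall n \near \oo, c <= iter m telescope u n) ->
  \forall n \near \oo, 0 < u n.
Proof.
(* A uniform bound [d] is carried through the induction, since a sequence with merely positive steps
   may stay negative. *)
move=> c0 uc; suff [d d0 [N _ ud]] :
    exists2 d : R, 0 < d & \forall n \near \oo, d <= u n.
  by exists N => // n /ud; exact: lt_le_trans.
elim: m u c c0 uc => [|m IH] u c c0; first by exists c.
rewrite iterSr => /(IH _ _ c0)[d d0 [N _ ud]]; exists d => //.
have growth k : u N + d *+ k <= u (N + k)%N.
  elim: k => [|k IHk]; first by rewrite addr0 addn0.
  rewrite mulrSr addrA addnS.
  have := ud (N + k)%N (leq_addr _ _); rewrite /telescope lerBrDl.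
  by move=> /(le_trans _); apply; rewrite lerD2r.
have [K NK] : exists K : nat, d - u N <= d *+ K.
  have [dN|dN] := leP (d - u N) 0; first by exists 0%N.
  exists (Num.bound ((d - u N) / d)); rewrite -mulr_natl -ler_pdivrMr// ltW//.
  by rewrite archi_boundP// divr_ge0// ltW.
exists (N + K)%N => // n /= NKn.
rewrite -(subnKC (leq_trans (leq_addr _ _) NKn)).
apply: le_trans (growth _); rewrite -lerBlDl (le_trans NK)//.
by rewrite ler_pMn2l// leq_subRL// (leq_trans _ NKn)// leq_addr.
Qed.

Lemma iter_telescope_near_lt (R : archiRealFieldType) (m : nat)
    (u v : nat -> R) :
  (forall n, iter m.+1 telescope u n = 0) ->
  (forall n, iter m.+1 telescope v n = 0) ->
  iter m telescope u 0 < iter m telescope v 0 ->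
  \forall n \near \oo, u n < v n.
Proof.
move=> u0 v0 uv; have d0 : 0 < iter m telescope v 0 - iter m telescope u 0.
  by rewrite subr_gt0.
have : \forall n \near \oo, 0 < v n - u n.
  apply: (@iter_telescope_near_gt0 R m _ _ d0); near=> n.
  by rewrite iter_telescopeB !(@iter_telescope_cst R m _ _ n).
by apply: filterS => n; rewrite subr_gt0.
Unshelve. all: by end_near. Qed.

Lemma powR_norm_continuous (R : realType) (p : R) : 0 < p ->
  continuous (fun r : R => `|r| `^ p).
Proof.
move=> p0 r; have [->|r0] := eqVneq r 0.
  rewrite /continuous_at normr0 powR0 ?gt_eqF//.
  apply/cvgrPdist_lt => e e0.
  (* At 0, where the power need not be differentiable, the radius is the [p]-th root of [e]. *)
  have d0 : 0 < e `^ p^-1 by rewrite powR_gt0.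
  near=> x; rewrite sub0r normrN ger0_norm ?powR_ge0//.
  rewrite -[ltRHS](@powRr1 _ e) ?ltW// -(mulVf (lt0r_neq0 p0)) powRrM.
  apply: gt0_ltr_powR => //; rewrite ?nnegrE ?powR_ge0//.
have powR_cont : {for `|r|, continuous (fun x : R => x `^ p)}.
  apply/differentiable_continuous/derivable1_diffP/derivable_powR.
  by rewrite in_itv/= normr_gt0 r0.
exact: (cvg_comp _ _ (@norm_continuous _ R r) powR_cont).
Unshelve. all: by end_near. Qed.
Lemma bounded_operator_continuous (K : numFieldType) (X : normedModType K)
    (T : {linear X -> X}) : bounded_operator T -> continuous T.
Proof.
case=> M TM x; apply/cvgrPdist_lt => e e0; near=> y.
rewrite -linearB (le_lt_trans (TM _))//.
have M0 : 0 < `|M| + 1 by rewrite ltr_wpDl.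
(* [M] is any element of [K], but the product bounds a norm, so it is nonnegative and equals its own
   norm. *)
have -> : M * `|x - y| = `|M| * `|x - y|.
  by rewrite -[LHS]ger0_norm ?(le_trans _ (TM _))// normrM normr_id.
rewrite (@le_lt_trans _ _ ((`|M| + 1) * `|x - y|))//.
  by rewrite ler_wpM2r// lerDl.
rewrite mulrC -ltr_pdivlMr//; near: y.
by apply: cvgr_dist_lt; rewrite ?divr_gt0//; exact: cvg_id.
Unshelve. all: by end_near. Qed.

Lemma iter_continuous (U : topologicalType) (f : U -> U) (n : nat) :
  continuous f -> continuous (iter n f).
Proof.
move=> fc; elim: n => [|n IH] x; first exact: cvg_id.
exact: (cvg_comp _ _ (IH x) (fc _)).
Qed.

Lemma iter_linearZ (K : pzRingType) (X : lmodType K) (T : {linear X -> X})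
    (n : nat) (a : K) : {morph iter n T : x / a *: x}.
Proof. by elim: n => // n IH x; rewrite !iterS IH linearZ. Qed.

Lemma iter_linearD (K : pzRingType) (X : lmodType K) (T : {linear X -> X})
    (n : nat) : {morph iter n T : x y / x + y}.
Proof. by elim: n => // n IH x y; rewrite !iterS IH linearD. Qed.

(** A bound by the larger norm survives raising to the power [p] even when [p < 1], where convexity
    of the norm would be lost. *)
Lemma norm_conv_le_max (K : numFieldType) (X : normedModType K) (t : K)
    (x y : X) : 0 <= t -> t <= 1 ->
  `|t *: x + (1 - t) *: y| <= `|x| \/ `|t *: x + (1 - t) *: y| <= `|y|.
Proof.
move=> t0 t1; have t1' : 0 <= 1 - t by rewrite subr_ge0.
have H : `|t *: x + (1 - t) *: y| <= t * `|x| + (1 - t) * `|y|.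
  by rewrite (le_trans (ler_normD _ _))// !normrZ !ger0_norm.
have conv_le (s u v : K) : 0 <= s -> u <= v -> s * u + (1 - s) * v <= v.
  move=> s0 uv; rewrite mulrBl mul1r addrCA -mulrBr gerDl.
  by rewrite mulr_ge0_le0// subr_le0.
have [xy|/ltW yx] := real_leP (normr_real x) (normr_real y); [right|left].
  exact: le_trans H (conv_le _ _ _ t0 xy).
by apply: le_trans H _; have := conv_le _ _ _ t1' yx; rewrite subKr addrC.
Qed.

Section OrbitPowers.
(** The assumptions on [re] hold both for the identity of [R] and for the real part on [R[i]], so
    one argument serves both fields. *)
Context (R : realType) (K : numFieldType) (re : K -> R).
Context (re_mulrn : forall x n, re (x *+ n) = re x *+ n).
Context (re_gt0 : forall x, 0 < x -> 0 < re x).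
Context (re_le : {homo re : x y / x <= y}).
Context (re_continuous : continuous re).
Context (X : normedModType K) (T : {linear X -> X}).
Context (T_continuous : continuous T).
Context (p : R) (p_gt0 : 0 < p).

Let a (x : X) (n : nat) : R := (re `|iter n T x|) `^ p.

Let re_norm_ge0 (x : X) : 0 <= re `|x|.
Proof. by have := re_mulrn 0 0; rewrite !mulr0n => <-; rewrite re_le. Qed.

Let a_iter (j : nat) (x : X) (n : nat) : a (iter j T x) n = a x (j + n).
Proof. by rewrite /a -iterD addnC. Qed.

(** The defining identity at [iter n T x] is the [m]-th difference of [a x] at [n]. *)
Let mp_isometryP (m : nat) : mp_isometry re m p T <->
  forall x n, iter m telescope (a x) n = 0.
Proof.
split=> [mT x n|mT x]; last by have := mT x 0; rewrite iter_telescopeE.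
rewrite iter_telescopeE -[RHS](mT (iter n T x)); apply: eq_bigr => k _.
by rewrite -/(a (iter n T x) k) a_iter.
Qed.

(* For an [(m + 1, p)]-isometry this is [m!] times the coefficient of [n ^ m]
   in the polynomial function [a x]. *)
Let lead (m : nat) (x : X) : R := iter m telescope (a x) 0.

Let lead_continuous (m : nat) : continuous (lead m).
Proof.
rewrite [lead m](_ : _ = fun x => \sum_(k < m.+1)
    (-1) ^+ (m - k) * 'C(m, k)%:R * a x k); last first.
  by apply/funext => x; rewrite /lead iter_telescopeE.
apply: (@continuous_big R _ +%R) => [|k _ x]; first exact: add_continuous.
apply: cvgMr; suff: continuous (a^~ k) by exact.
rewrite (_ : a^~ k = fun x => `|re `|iter k T x| | `^ p); last first.
  by apply/funext => y; rewrite ger0_norm.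
move=> {}x; have ck := @iter_continuous X T k T_continuous x.
have cn := cvg_comp _ _ ck (@norm_continuous _ X _).
have cr := cvg_comp _ _ cn (re_continuous _).
exact: (cvg_comp _ _ cr (@powR_norm_continuous R p p_gt0 _)).
Qed.

(** Homogeneity for natural multiples, which [re] respects, is enough to make a positive lead
    unbounded. *)
Let lead_mulrn (m : nat) (x : X) (k : nat) :
  lead m (x *+ k) = k%:R `^ p * lead m x.
Proof.
rewrite /lead !iter_telescopeE mulr_sumr; apply: eq_bigr => j _.
rewrite mulrCA /a -powRM ?ler0n//; congr (_ * _ `^ p).
rewrite -scaler_nat iter_linearZ normrZ normr_nat mulr_natl.
by rewrite re_mulrn mulr_natl.
Qed.

Lemma mp_isometry_not_convex_cyclic (m : nat) : (exists x : X, x != 0) ->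
  mp_isometry re m p T -> ~ convex_cyclic T.
Proof.
case=> x1 x1_neq0 /mp_isometryP; elim: m => [|m IH] mT.
  have := mT x1 0; rewrite /= /a /= => /powR_eq0_eq0 re0.
  by have := @re_gt0 `|x1|; rewrite normr_gt0 re0 ltxx => /(_ x1_neq0).
have [lead0|] := pselect (forall x, lead m x = 0).
  apply: IH => x n.
  by rewrite (iter_telescope_cst _ _ _ (mT x)) -[LHS]/(lead m x).
move=> /existsNP[y /eqP lead_y]; case=> x0 x0_dense.
have lead_ge0 x : 0 <= lead m x.
  rewrite leNgt; apply/negP => lead_lt0.
  have z0 : forall k n, iter k telescope (fun=> 0 : R) n = 0.
    by move=> k n; rewrite iter_telescopeE big1// => i _; rewrite mulr0.
  have [] := @iter_telescope_near_lt R m (a x) (fun=> 0) (mT x) (z0 _).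
    by rewrite z0.
  by move=> N _ /(_ N (leqnn N)) /=; rewrite ltNge powR_ge0.
pose A : set X := [set x | lead m x <= lead m x0].
have A_orbit : orbit_of T x0 `<=` A.
  move=> _ [n _ <-]; rewrite /A /= /lead.
  rewrite (_ : a _ = fun k => a x0 (n + k)%N); last first.
    by apply/funext => k; rewrite a_iter.
  (* Moving along the orbit shifts [a x0], which leaves its constant difference unchanged. *)
  rewrite -[leRHS](iter_telescope_cst _ _ _ (mT x0) n) !iter_telescopeE.
  by apply: ler_sum => k _; rewrite add0n.
have A_convex : convex_set A.
  move=> x y' t; rewrite !inE /A /= => xA yA.
  rewrite leNgt; apply/negP => lt_lead.
  have [N1 _ ltx] :=
    iter_telescope_near_lt _ _ _ _ (mT x) (mT _) (le_lt_trans xA lt_lead).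
  have [N2 _ lty] :=
    iter_telescope_near_lt _ _ _ _ (mT y') (mT _) (le_lt_trans yA lt_lead).
  (* At an index past both thresholds the convex combination would have an iterate of norm above
     both endpoints' iterates. *)
  have /= {ltx} := ltx (N1 + N2)%N (leq_addr _ _).
  have /= {lty} := lty (N1 + N2)%N (leq_addl _ _).
  set n := (N1 + N2)%N; rewrite /a.
  have -> : iter n T (conv t x y') =
     t%:num *: iter n T x + (1 - t%:num) *: iter n T y'.
    by rewrite -!iter_linearZ -iter_linearD.
  have [] := @norm_conv_le_max K X t%:num (iter n T x) (iter n T y').
  - by [].
  - by [].
  - move=> /re_le h _; rewrite ltNge => /negP; apply.
    by apply: ge0_ler_powR h; rewrite ?nnegrE//; exact: ltW.
  - move=> /re_le h; rewrite ltNge => /negP + _; apply.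
    by apply: ge0_ler_powR h; rewrite ?nnegrE//; exact: ltW.
have hullA := smallest_sub A_convex A_orbit.
have [||z [zA /hullA]] := x0_dense (~` A).
- have lead_y0 : 0 < lead m y by rewrite lt_neqAle eq_sym lead_y lead_ge0.
  pose b := lead m x0 / lead m y.
  have b0 : 0 <= b by rewrite divr_ge0.
  (* Chosen so that [k] to the power [p] exceeds [b], which puts [y *+ k] outside [A]. *)
  pose k := Num.bound (b `^ p^-1).
  exists (y *+ k); rewrite /A /=; apply/negP; rewrite -ltNge lead_mulrn.
  rewrite -ltr_pdivrMr// -/b.
  have -> : b = (b `^ p^-1) `^ p by rewrite -powRrM mulVf ?powRr1 ?gt_eqF.
  apply: gt0_ltr_powR => //; rewrite ?nnegrE ?powR_ge0 ?ler0n//.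
  by apply: archi_boundP; rewrite powR_ge0.
- rewrite (_ : ~` A = lead m @^-1` [set r | lead m x0 < r]).
    by apply: open_comp => [x _|]; [exact: lead_continuous|exact: open_gt].
  by apply/seteqP; split=> x; rewrite /A /= ltNge => /negP.
- exact: zA.
Qed.

End OrbitPowers.

Lemma complex_Re_continuous (R : realType) :
  continuous (@complex.Re R : (R[i] : numFieldType) -> R).
Proof.
move=> z; apply/(@cvgrPdist_lt _ R _ _ (nbhs_filter z)) => e e0; near=> w.
rewrite -raddfB -(ltcR (R := R)) (le_lt_trans (normc_ge_Re _))//; near: w.
by exists e%:C%C => //=; rewrite ltcR.
Unshelve. all: by end_near. Qed.

(* First conjunct: real Banach spaces; second conjunct: complex ones. *)
Theorem theorem4p1 (R : realType) (m : nat) (m_gt0 : (0 < m)%N) :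
  (forall (X : completeNormedModType R) (T : {linear X -> X}),
      (exists x : X, x != 0) ->
      bounded_operator T ->
      m_isometry (fun r : R => r) m T ->
      ~ convex_cyclic T) /\
  (forall (X : completeNormedModType R[i]) (T : {linear X -> X}),
      (exists x : X, x != 0) ->
      bounded_operator T ->
      m_isometry (@complex.Re R) m T ->
      ~ convex_cyclic T).
Proof.
split=> X T X_neq0 /bounded_operator_continuous T_cont [p p_gt0].
  apply: (@mp_isometry_not_convex_cyclic R R (fun r => r)) => // x.
  exact: cvg_id.
apply: (@mp_isometry_not_convex_cyclic R R[i] (@complex.Re R)) => //.
- by move=> z n; rewrite raddfMn.
- by move=> z; rewrite ltcE => /andP[].
- by move=> z w; rewrite lecE => /andP[].
- exact: complex_Re_continuous.
Qed.
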